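(* Let $P^{\mathrm{D}}_n(t)=\sum_{k=0}^nD(n,k)t^k$. For every $t\ge0$, $\int_{\mathbb{R}}x^n\,d\mu^{\mathrm{D}}_t(x)=P^{\mathrm{D}}_n(t)$ for all $n\ge0$, where $\mu^{\mathrm{D}}_t$ is the probability measure given by $\mu^{\mathrm{D}}_0=\delta_1$, \[\mu^{\mathrm{D}}_t=\frac{2-t}{2}\delta_{1-t}+\sum_{k=1}^{\infty}\frac{(1-t)t^k}{2}\delta_{(2k+1)(1-t)}\quad\text{if }0<t<1,\] \[\mu^{\mathrm{D}}_1=\tfrac12\delta_0+\tfrac14e^{-x/2}\chi_{[0,+\infty)}(x)\,dx,\] \[\mu^{\mathrm{D}}_t=\tfrac12\delta_{1-t}+\sum_{k=0}^{\infty}\frac{t-1}{2t^{k+1}}\delta_{(2k+1)(t-1)}\quad\text{if }t>1.\] In particular $\{P^{\mathrm{D}}_n(t)\}_{n\ge0}$ is positive definite for $t\ge0$.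
   Context: $\mathcal{B}_n$ is the group of permutations $\sigma$ of $\{-n,\dots,n\}$ with $\sigma(-k)=-\sigma(k)$ for all $k$. For $\sigma\in\mathcal{B}_n$, $\mathrm{desc}(\sigma)$ is the number of $i\in\{0,\dots,n-1\}$ with $\sigma(i)>\sigma(i+1)$ (descends of $(0,\sigma(1),\dots,\sigma(n))$). $\mathcal{D}_n$ is the set of $\sigma\in\mathcal{B}_n$ such that $\{\sigma(1),\dots,\sigma(n)\}$ contains an even number of negative elements. $D(n,k)=\#\{\sigma\in\mathcal{D}_n:\mathrm{desc}(\sigma)=k\}$. $\delta_a$ is the Dirac measure at $a$. A real sequence $\{a_n\}$ is positive definite if $\sum_{i,j}a_{i+j}c_ic_j\ge0$ for all finitely supported real $\{c_i\}$. *)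

(* Defs.v *)
From HB Require Import structures.
From mathcomp Require Import all_boot all_order all_fingroup all_algebra.
From mathcomp Require Import all_classical all_reals all_analysis.
Set Implicit Arguments.
Unset Strict Implicit.
Unset Printing Implicit Defensive.
Import Order.TTheory GRing.Theory Num.Theory.
Import numFieldNormedType.Exports.
Local Open Scope classical_set_scope.
Local Open Scope ring_scope.

(* The set {-n, ..., n} is encoded as 'I_(n.*2.+1): the ordinal i stands for
   the integer i - n, so that rev_ord is negation (lemma signed_val_rev). *)
Definition signed_val n (i : 'I_(n.*2.+1)) : int := (i : nat)%:Z - n%:Z.

(* The encoding of the integer k, meaningful for k <= n. *)
Definition signed_ord n (k : nat) : 'I_(n.*2.+1) := inord (n + k)%N.

Lemma signed_val_rev n (i : 'I_(n.*2.+1)) :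
  signed_val (rev_ord i) = - signed_val i.
Proof.
have ile : (i <= n.*2)%N by rewrite -ltnS ltn_ord.
have dbl : n.*2 = n%:Z + n%:Z :> int by rewrite -PoszD addnn.
by rewrite /signed_val /= subSS -subzn // dbl opprB addrAC addrK.
Qed.

Lemma signed_val_ord n k : (k <= n)%N -> signed_val (signed_ord n k) = k%:Z.
Proof.
move=> kn; rewrite /signed_val /signed_ord inordK; last first.
  by rewrite ltnS -addnn leq_add2l.
by rewrite PoszD addrAC subrr add0r.
Qed.

Definition signed_perms n : {set 'S_(n.*2.+1)} :=
  [set s : 'S_(n.*2.+1) | [forall i, s (rev_ord i) == rev_ord (s i)]]%SET.

Definition signed_app n (s : 'S_(n.*2.+1)) (k : nat) : int :=
  signed_val (s (signed_ord n k)).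

Definition desc n (s : 'S_(n.*2.+1)) : nat :=
  #|[set i : 'I_n | signed_app s i > signed_app s i.+1]%SET|.

Definition pos_image n (s : 'S_(n.*2.+1)) : {set 'I_(n.*2.+1)} :=
  [set s (signed_ord n k.+1) | k : 'I_n]%SET.

Definition even_signed_perms n : {set 'S_(n.*2.+1)} :=
  [set s in signed_perms n |
    ~~ odd #|[set j in pos_image s | (signed_val j < 0)%R]%SET| ]%SET.

Definition eulerianD (n k : nat) : nat :=
  #|[set s in even_signed_perms n | desc s == k]%SET|.

Definition polyD (R : realType) (n : nat) (t : R) : R :=
  \sum_(0 <= k < n.+1) (eulerianD n k)%:R * t ^+ k.

(* Relevant for t >= 0 only. *)
Definition muD (R : realType) (t : R) (A : set (measurableTypeR R)) : \bar R :=
  if t == 0 then \d_(1 : measurableTypeR R) A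
  else if t < 1 then
    (((2 - t) / 2)%:E * \d_((1 - t)%R : measurableTypeR R) A
     + \sum_(1 <= k <oo) (((1 - t) * t ^+ k / 2)%:E
         * \d_(((2 * k + 1)%:R * (1 - t))%R : measurableTypeR R) A))%E
  else if t == 1 then
    ((2^-1)%:E * \d_(0%R : measurableTypeR R) A
     + \int[lebesgue_measure]_(x in A)
         (4^-1 * expR (- x / 2) * \1_(`[0, +oo[ : set R) x)%:E)%E
  else
    ((2^-1)%:E * \d_((1 - t)%R : measurableTypeR R) A
     + \sum_(0 <= k <oo) (((t - 1) / (2 * t ^+ k.+1))%:E
         * \d_(((2 * k + 1)%:R * (t - 1))%R : measurableTypeR R) A))%E.

Definition positive_definite_seq (R : realType) (a : nat -> R) : Prop :=
  forall (c : nat -> R) (N : nat), (forall i, (N <= i)%N -> c i = 0) ->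
  0 <= \sum_(0 <= i < N) \sum_(0 <= j < N) a (i + j)%N * c i * c j.

(* Main.v *)
Require Import Defs.
From HB Require Import structures.
From mathcomp Require Import all_boot all_order all_fingroup all_algebra.
From mathcomp Require Import all_classical all_reals all_analysis.
From mathcomp Require Import measurable_realfun ring zify.
Set Implicit Arguments.
Unset Strict Implicit.
Unset Printing Implicit Defensive.
Import Order.TTheory GRing.Theory Num.Theory.
Import numFieldNormedType.Exports.
Local Open Scope classical_set_scope.
Local Open Scope ring_scope.

(* Write W_n(q, t) for the sum of q^neg t^desc over the signed permutations of
   size n, so that P_n^D(t) = (W_n(1, t) + W_n(-1, t)) / 2.  Inserting the
   letters n+1 and -(n+1) in all positions of a signed word gives a recurrence
   for W_n, from which W_n(-1, t) = (1 - t)^n (the Dirac mass at 1 - t) and the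
   Worpitzky identities
     (2k+1)^n = sum_w 'C(k + n - desc w, n) = sum_w 'C(k + desc w, n)
   follow.  Summing the first identity against t^k for t < 1, or the second one
   against t^-k for t > 1, turns W_n(1, t) into the n-th moment of a geometric
   distribution on the odd multiples of |1 - t|; at t = 1, W_n(1, 1) = 2^n n! is
   the n-th moment of the exponential distribution of rate 1/2. *)

(** * Signed words and the insertion recurrence *)

(** The letter [x] in front of the word is a parameter so that inductions can pass to the tail;
    [x = 0] is the convention sigma(0) = 0. *)
Fixpoint descents (x : int) (w : seq int) : nat :=
  if w is y :: w' then ((y < x)%R + descents y w')%N else 0%N.

Definition negatives (w : seq int) : nat := count (fun x : int => x < 0) w.

Fixpoint insertions (T : Type) (a : T) (w : seq T) : seq (seq T) :=
  if w is y :: w' then (a :: w) :: [seq y :: u | u <- insertions a w']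
  else [:: [:: a]].

Fixpoint signed_words (n : nat) : seq (seq int) :=
  if n is m.+1 then
    [seq u | w <- signed_words m,
             u <- insertions m.+1%:Z w ++ insertions (- m.+1%:Z) w]
  else [:: [::]].

Lemma insertions_perm (T : eqType) (a : T) (w u : seq T) :
  u \in insertions a w -> perm_eq u (a :: w).
Proof.
elim: w u => [|y w IH] u /=; first by rewrite inE => /eqP ->.
rewrite inE => /orP[/eqP -> //|/mapP[v /IH vp ->]].
apply: (perm_trans (y := y :: a :: w)); first by rewrite perm_cons.
exact/permPl/(perm_catCA [:: y] [:: a] w).
Qed.

Lemma mem_insertions_cat (T : eqType) (a : T) (p s : seq T) :
  p ++ a :: s \in insertions a (p ++ s).
Proof.
elim: p => [|y p IH] /=; last by rewrite inE map_f ?orbT.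
by case: s => [|y s] /=; rewrite mem_head.
Qed.

Lemma insertions_uniq (T : eqType) (a : T) (w : seq T) :
  a \notin w -> uniq (insertions a w).
Proof.
elim: w => [//|y w IH] /=; rewrite inE negb_or => /andP[ay /IH uw].
rewrite map_inj_uniq ?uw ?andbT; last by move=> u v [].
by apply/mapP => -[u _ [/eqP]]; rewrite (negPf ay).
Qed.

(** Makes insertion reversible: with [P] rejecting the largest absolute value, distinct words of
    [signed_words] have no insertion in common. *)
Lemma insertions_filter (T : eqType) (P : pred T) (a : T) (w u : seq T) :
  ~~ P a -> all P w -> u \in insertions a w -> [seq x <- u | P x] = w.
Proof.
move=> Pa; elim: w u => [|y w IH] u /=.
  by rewrite inE => _ /eqP -> /=; rewrite (negPf Pa).
move=> /andP[Py Pw]; rewrite inE => /orP[/eqP ->|/mapP[v vw ->]] /=.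
  by rewrite (negPf Pa) Py; congr cons; apply/all_filterP.
by rewrite Py (IH v).
Qed.

(** Induction on [n]: one direction inserts the letter of absolute value [n.+1], the other locates
    and deletes it. *)
Lemma mem_signed_words n w :
  (w \in signed_words n) = perm_eq [seq `|x|%N | x <- w] (iota 1 n).
Proof.
have iotar m : perm_eq (m.+1 :: iota 1 m) (iota 1 m.+1).
  by rewrite -(addn1 m) iotaD cats1 add1n perm_sym perm_rcons addn1.
elim: n w => [|n IH] w.
  by rewrite inE; case: w => [|x w] //=; apply/esym/negbTE/negP => /perm_size.
apply/allpairsPdep/idP => [[w' [u [w'n]]]|pw].
  have abs_ins a : u \in insertions a w' -> `|a|%N = n.+1 ->
      perm_eq [seq `|x|%N | x <- u] (iota 1 n.+1).
    move=> /insertions_perm /(perm_map absz) /perm_trans + an; apply.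
    rewrite /= an; apply: perm_trans (iotar n).
    by rewrite perm_cons -IH.
  by rewrite mem_cat => /orP[] /abs_ins + -> => -> //; rewrite abszN.
have /mapP[a aw an] : n.+1 \in [seq `|x|%N | x <- w].
  by rewrite (perm_mem pw) -(perm_mem (iotar n)) mem_head.
move: pw; case/splitPr: aw => p s pw.
exists (p ++ s), (p ++ a :: s); split => //.
  rewrite IH -(perm_cons n.+1) (permPr (iotar n)) -(permPr pw) !map_cat /= an.
  by rewrite perm_sym; apply/permPl/(perm_catCA _ [:: _] _).
rewrite mem_cat; apply/orP.
have [->|->] : a = n.+1%:Z \/ a = - n.+1%:Z by move: an; clear; lia.
  by left; apply: mem_insertions_cat.
by right; apply: mem_insertions_cat.
Qed.

Lemma signed_words_size n w : w \in signed_words n -> size w = n.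
Proof. by rewrite mem_signed_words => /perm_size; rewrite size_map size_iota. Qed.

Lemma signed_words_bound n w x :
  w \in signed_words n -> x \in w -> (0 < `|x| <= n)%N.
Proof.
rewrite mem_signed_words => /perm_mem wn /(map_f absz).
by rewrite wn mem_iota add1n ltnS.
Qed.

Lemma signed_words_uniq n : uniq (signed_words n).
Proof.
elim: n => //= n IH; apply: allpairs_uniq_dep => //.
- move=> w wn; have nw a : `|a|%N = n.+1 -> a \notin w.
    by move=> an; apply/negP => /(signed_words_bound wn); rewrite an ltnn andbF.
  rewrite cat_uniq !insertions_uniq ?nw ?abszN // andbT /=.
  (* The two signs give disjoint lists: a common word would be a rearrangement of [w] with [- n.+1]
     added, yet contain [n.+1]. *)
  apply/hasPn => u /insertions_perm /perm_mem uN; apply/negP.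
  move=> /insertions_perm /perm_mem /(_ n.+1%:Z).
  by rewrite uN !inE eqxx (negPf (nw _ _)) // orbF; lia.
- move=> p1 p2 /allpairsPdep[w1 [u1 [w1n u1w ->]]].
  move=> /allpairsPdep[w2 [u2 [w2n u2w ->]]] /= eu; subst u2.
  suff fw w : w \in signed_words n ->
      u1 \in insertions n.+1%:Z w ++ insertions (- n.+1%:Z) w ->
      [seq x <- u1 | `|x|%N != n.+1] = w.
    by rewrite -(fw w1) // -(fw w2).
  move=> wn; have Pw : all (fun x : int => `|x|%N != n.+1) w.
    apply/allP => x /(signed_words_bound wn) /andP[_ xn].
    by rewrite neq_ltn ltnS xn.
  by rewrite mem_cat => /orP[] /insertions_filter -> //; rewrite ?abszN eqxx.
Qed.

Lemma descents_le_size x w : (descents x w <= size w)%N.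
Proof. by elim: w x => //= y w IH x; have := IH y; case: (y < x)%R => /=; lia. Qed.

(** A letter above all others creates no new descent when placed inside a descent or at the end, and
    exactly one in each remaining gap. *)
Lemma sum_insert_max (R : comNzRingType) (G : nat -> R) (a x : int) w :
  all (fun y => y < a) (x :: w) ->
  \sum_(u <- insertions a w) G (descents x u) =
  (descents x w).+1%:R * G (descents x w) +
  ((size w)%:R - (descents x w)%:R) * G (descents x w).+1.
Proof.
elim: w x G => [|y w IH] x G /= /andP[xa].
  by move=> _; rewrite big_seq1 /= addn0 ltNge (ltW xa) /=; ring.
move=> /andP[ya wa]; rewrite big_cons big_map /= ya ltNge (ltW xa) /=.
rewrite (IH y (fun d => G ((y < x)%R + d)%N)) /= ?ya //.
by case: (y < x)%R; rewrite /= ?add0n ?add1n -?[in _.+2%:R]natr1 -?natr1; ring.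
Qed.

(** A letter below all others leaves the count unchanged only inside a descent; at the end it now
    adds one. *)
Lemma sum_insert_min (R : comNzRingType) (G : nat -> R) (a x : int) w :
  all (fun y => a < y) (x :: w) ->
  \sum_(u <- insertions a w) G (descents x u) =
  (descents x w)%:R * G (descents x w) +
  ((size w).+1%:R - (descents x w)%:R) * G (descents x w).+1.
Proof.
elim: w x G => [|y w IH] x G /= /andP[ax].
  by move=> _; rewrite big_seq1 /= ax /=; ring.
move=> /andP[ay wa]; rewrite big_cons big_map /= ax ltNge (ltW ay) /=.
rewrite (IH y (fun d => G ((y < x)%R + d)%N)) /= ?ay //.
by case: (y < x)%R; rewrite /= ?add0n ?add1n -?natr1; ring.
Qed.

(* [G] is a power of t or a binomial coefficient in the applications. *)
Lemma sum_signed_wordsS (R : comNzRingType) (q : R) (G : nat -> R) n :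
  \sum_(w <- signed_words n.+1) q ^+ negatives w * G (descents 0 w) =
  \sum_(w <- signed_words n) q ^+ negatives w *
    ((1 + (1 + q) * (descents 0 w)%:R) * G (descents 0 w) +
     (n%:R + q * n.+1%:R - (1 + q) * (descents 0 w)%:R) * G (descents 0 w).+1).
Proof.
rewrite big_allpairs_dep /= big_seq [RHS]big_seq; apply: eq_bigr => w wn.
have wb y : y \in w -> - n.+1%:Z < y < n.+1%:Z.
  by move=> /(signed_words_bound wn); lia.
(* The number of negative letters does not depend on where [a] is inserted, so the power of [q]
   factors out. *)
have pull a : \sum_(u <- insertions a w) q ^+ negatives u * G (descents 0 u) =
    q ^+ ((a < 0)%R + negatives w) * \sum_(u <- insertions a w) G (descents 0 u).
  rewrite big_distrr /= big_seq [RHS]big_seq; apply: eq_bigr => u.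
  by move=> /insertions_perm /seq.permP uw; rewrite /negatives uw.
rewrite big_cat /= !pull sum_insert_max; last first.
  by apply/allP => y; rewrite inE => /orP[/eqP -> //|/wb /andP[]].
rewrite sum_insert_min; last first.
  by apply/allP => y; rewrite inE => /orP[/eqP -> //|/wb /andP[]].
rewrite /= add0n add1n exprS (signed_words_size wn) -!natr1.
by ring.
Qed.

(** At [q = -1] every term of the recurrence that involves [1 + q] vanishes, and each step just
    multiplies by [1 - t]. *)
Lemma sum_signed_words_sign (R : comNzRingType) (t : R) n :
  \sum_(w <- signed_words n) (-1) ^+ negatives w * t ^+ descents 0 w =
  (1 - t) ^+ n.
Proof.
elim: n => [|n IH]; first by rewrite big_seq1 /= /negatives /= mulr1.
rewrite (sum_signed_wordsS (-1) (fun d => t ^+ d)) exprS -IH big_distrr /=.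
by apply: eq_bigr => w _; rewrite exprS -natr1; ring.
Qed.

Lemma size_signed_words n : size (signed_words n) = (2 ^ n * n`!)%N.
Proof.
suff : (\sum_(w <- signed_words n) 1 = (2 ^ n * n`!)%:Z)%R.
  by rewrite big_const_seq count_predT iter_addr_0 natz => -[].
elim: n => [|n IH]; first by rewrite big_seq1.
have := sum_signed_wordsS 1 (fun=> 1 : int) n.
under eq_bigr do rewrite expr1n mulr1; move=> ->.
transitivity ((2 * n.+1)%:R * \sum_(w <- signed_words n) 1 : int).
  rewrite big_distrr /=; apply: eq_bigr => w _.
  by rewrite expr1n natrM -natr1; ring.
by rewrite IH natz -PoszM factS expnS; congr Posz; ring.
Qed.

(** The subtraction is taken in the ring, so that the identity also covers [m < n], where both
    binomials are zero. *)
Lemma bin_absorb (R : comNzRingType) m n :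
  n.+1%:R * 'C(m, n.+1)%:R = (m%:R - n%:R) * 'C(m, n)%:R :> R.
Proof.
rewrite -natrM mul_bin_left; have [nm|mn] := leqP n m.
  by rewrite natrM natrB.
by rewrite bin_small // muln0 mulr0.
Qed.

(* The two expansions are exchanged by the reciprocity k |-> - k - 1. *)
Lemma worpitzky (R : comNzRingType) (q : R) n k :
  ((1 + q) * k%:R + 1) ^+ n =
  \sum_(w <- signed_words n)
    q ^+ negatives w * 'C(k + (n - descents 0 w), n)%:R.
Proof.
elim: n => [|n IH]; first by rewrite big_seq1 /= /negatives /= bin0 mulr1.
rewrite (sum_signed_wordsS q (fun d => 'C(k + (n.+1 - d), n.+1)%:R)).
rewrite exprSr IH big_distrl /= big_seq [RHS]big_seq.
apply: eq_bigr => w wn; set d := descents 0 w.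
have dn : (d <= n)%N by rewrite -(signed_words_size wn) descents_le_size.
rewrite subSn // addnS binS subSS -mulrA; congr (_ * _).
have E := bin_absorb R (k + (n - d)) n.
rewrite natrD natrB // in E; rewrite natrD.
apply/eqP; rewrite -subr_eq0; apply/eqP.
(* After Pascal's rule the two sides differ by [1 + q] times the defect of the absorption identity
   [E]. *)
transitivity ((1 + q) * ((k%:R + (n%:R - d%:R) - n%:R) * 'C(k + (n - d), n)%:R -
   n.+1%:R * 'C(k + (n - d), n.+1)%:R) : R); first by rewrite -natr1; ring.
by rewrite E subrr mulr0.
Qed.

Lemma worpitzky_dual (R : comNzRingType) (q : R) n k :
  ((1 + q) * k%:R + q) ^+ n =
  \sum_(w <- signed_words n) q ^+ negatives w * 'C(k + descents 0 w, n)%:R.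
Proof.
elim: n => [|n IH]; first by rewrite big_seq1 /= /negatives /= bin0 mulr1.
rewrite (sum_signed_wordsS q (fun d => 'C(k + d, n.+1)%:R)).
rewrite exprSr IH big_distrl /=; apply: eq_bigr => w _.
set d := descents 0 w; rewrite addnS binS -mulrA; congr (_ * _).
have E := bin_absorb R (k + d) n.
rewrite natrD in E; rewrite natrD.
apply/eqP; rewrite -subr_eq0; apply/eqP.
transitivity ((1 + q) * ((k%:R + d%:R - n%:R) * 'C(k + d, n)%:R -
   n.+1%:R * 'C(k + d, n.+1)%:R) : R); first by rewrite -natr1; ring.
by rewrite E subrr mulr0.
Qed.

(** * Signed permutations as signed words *)

Definition word_of n (s : 'S_(n.*2.+1)) : seq int :=
  mkseq (fun k => signed_app s k.+1) n.

Lemma signed_val_inj n : injective (@signed_val n).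
Proof. by move=> i j; rewrite /signed_val => ij; apply: val_inj => /=; lia. Qed.

Lemma signed_val_bound n (i : 'I_(n.*2.+1)) : (`|signed_val i| <= n)%N.
Proof. by have := ltn_ord i; rewrite /signed_val; lia. Qed.

(** Reduces a statement about an odd permutation to its values on 0, ..., n. *)
Lemma signed_ord_or_rev n (i : 'I_(n.*2.+1)) :
  exists2 k, (k <= n)%N & i = signed_ord n k \/ i = rev_ord (signed_ord n k).
Proof.
exists `|signed_val i|%N; first exact: signed_val_bound.
have [i0|i0] := leP 0 (signed_val i); [left|right]; apply: signed_val_inj;
  by rewrite ?signed_val_rev signed_val_ord ?signed_val_bound //; move: i0; lia.
Qed.

Lemma signed_permsP n (s : 'S_(n.*2.+1)) :
  reflect (forall i, s (rev_ord i) = rev_ord (s i)) (s \in signed_perms n).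
Proof. by rewrite inE; apply: (iffP forallP) => H i; apply/eqP. Qed.

Lemma signed_app0 n (s : 'S_(n.*2.+1)) :
  s \in signed_perms n -> signed_app s 0 = 0.
Proof.
move=> /signed_permsP sP.
have r0 : rev_ord (signed_ord n 0) = signed_ord n 0.
  by apply: signed_val_inj; rewrite signed_val_rev signed_val_ord.
have := signed_val_rev (s (signed_ord n 0)); rewrite -sP r0 /signed_app; lia.
Qed.

Lemma nth_word_of n (s : 'S_(n.*2.+1)) k : s \in signed_perms n ->
  (k <= n)%N -> nth 0 (0 :: word_of s) k = signed_app s k.
Proof.
by case: k => [|k] sP kn /=; rewrite ?signed_app0 // nth_mkseq.
Qed.

Lemma word_of_inj n : {in signed_perms n &, injective (@word_of n)}.
Proof.
move=> s s' sP s'P ss'; apply/permP => i; apply: signed_val_inj.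
have E k : (k <= n)%N -> s (signed_ord n k) = s' (signed_ord n k).
  by move=> kn; apply: signed_val_inj; have := nth_word_of sP kn;
    rewrite ss' nth_word_of.
move/signed_permsP: sP => sP; move/signed_permsP: s'P => s'P.
by have [k kn [->|->]] := signed_ord_or_rev i; rewrite ?sP ?s'P E.
Qed.

(** Equal absolute values mean s(k) = s(l) or s(k) = s(-l), hence k = l or k = -l; for nonnegative
    indices both give k = l. *)
Lemma signed_app_abs_inj n (s : 'S_(n.*2.+1)) k l : s \in signed_perms n ->
  (k <= n)%N -> (l <= n)%N -> `|signed_app s k|%N = `|signed_app s l|%N -> k = l.
Proof.
move=> /signed_permsP sP kn ln kl.
have [e|e] : signed_app s k = signed_app s l \/
             signed_app s k = signed_val (s (rev_ord (signed_ord n l))).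
- by rewrite sP signed_val_rev -/(signed_app s l); move: kl; lia.
- have /perm_inj/(congr1 (@signed_val n)) := signed_val_inj e.
  by rewrite !signed_val_ord //; lia.
- have /perm_inj/(congr1 (@signed_val n)) := signed_val_inj e.
  by rewrite signed_val_rev !signed_val_ord //; lia.
Qed.

Lemma word_of_signed_words n (s : 'S_(n.*2.+1)) :
  s \in signed_perms n -> word_of s \in signed_words n.
Proof.
move=> sP; rewrite mem_signed_words /word_of /mkseq -map_comp.
set t := map _ _.
have ut : uniq t.
  rewrite map_inj_in_uniq ?iota_uniq // => k l; rewrite !mem_iota /= => kn ln.
  by move/(signed_app_abs_inj sP) => /(_ kn ln) [].
have st : {subset t <= iota 1 n}.
  move=> x /mapP[k]; rewrite mem_iota /= => kn ->.
  (* The value 0 is already taken at index 0, so no later index can have it. *)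
  rewrite mem_iota add1n ltnS signed_val_bound andbT lt0n; apply/eqP => k0.
  have := @signed_app_abs_inj n s k.+1 0 sP kn isT.
  by rewrite signed_app0 // k0 => /(_ erefl).
have sz : size (iota 1 n) = size t by rewrite size_map !size_iota.
have := uniq_min_size ut st; rewrite sz leqnn => /(_ isT) [_ E].
by apply: uniq_perm; rewrite ?iota_uniq.
Qed.

Lemma signed_words_word_of n w :
  w \in signed_words n -> exists2 s, s \in signed_perms n & word_of s = w.
Proof.
move=> wn; have sw := signed_words_size wn.
(* The odd extension of [w] to {-n, ..., n}; the 0 prepended to [w] is the value at 0. Below, [f]
   encodes it as an ordinal. *)
pose v (i : 'I_(n.*2.+1)) : int :=
  Num.sg (signed_val i) * nth 0 (0 :: w) `|signed_val i|.
have wb k : (k < n)%N -> (`|nth 0%R w k| <= n)%N.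
  rewrite -sw => kn.
  by case/andP: (signed_words_bound wn (mem_nth 0 kn)); rewrite sw.
have vb i : (`|v i| <= n)%N.
  rewrite /v abszM -[X in (_ <= X)%N]mul1n leq_mul //.
    by case: sgrP.
  by move: (signed_val_bound i); case: `|_|%N => [|k] //= /wb.
pose f i : 'I_(n.*2.+1) := inord `|v i + n%:Z|.
have fv i : signed_val (f i) = v i.
  move: (vb i); rewrite /signed_val /f; move: (v i) => x xn.
  by rewrite inordK; lia.
(* No letter of [w] is 0, so the absolute values stay distinct, and that of [v i] determines that of
   [signed_val i]. *)
have uw : uniq [seq `|x|%N | x <- 0 :: w].
  rewrite /= (perm_uniq (_ : perm_eq _ (iota 1 n))) -?mem_signed_words //.
  rewrite iota_uniq andbT.
  by apply/mapP => -[x /(signed_words_bound wn) + x0]; rewrite -x0.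
have nwb (i : 'I_(n.*2.+1)) : (`|signed_val i| < size (0%R :: w))%N.
  by rewrite /= sw ltnS signed_val_bound.
have f_inj : injective f.
  move=> i j /(congr1 (@signed_val n)); rewrite !fv => vij; apply: signed_val_inj.
  have absv k : `|v k|%N = nth 0%N [seq `|x|%N | x <- 0 :: w] `|signed_val k|.
    rewrite (nth_map 0) // /v abszM.
    case: (ltgtP (signed_val k) 0) => [k0|k0|->]; last by rewrite sgr0.
      by rewrite ltr0_sg // abszN; exact: mul1n.
    by rewrite gtr0_sg //; exact: mul1n.
  have aij : `|signed_val i|%N = `|signed_val j|%N.
    apply/eqP; rewrite -(nth_uniq 0%N _ _ uw) ?size_map //.
    by rewrite -!absv vij.
  have [//|ij] : signed_val i = signed_val j \/ signed_val i = - signed_val j.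
    by move: aij; lia.
  (* For opposite arguments, oddness and [v i = v j] force [v i = 0], a value found only at position
     0; hence both arguments are 0. *)
  have vn : v i = - v j by rewrite /v ij abszN sgrN mulNr.
  have v0 : v i = 0 by move: vij vn; lia.
  move: (absv i); rewrite v0 => /esym/eqP.
  rewrite -[X in _ == X]/(nth 0%N [seq `|x|%N | x <- 0 :: w] 0%N).
  by rewrite nth_uniq ?size_map //; move: ij; lia.
exists (perm f_inj).
  apply/signed_permsP => i; rewrite !permE; apply: signed_val_inj.
  by rewrite signed_val_rev !fv /v signed_val_rev abszN sgrN mulNr.
apply: (@eq_from_nth _ 0); rewrite ?size_mkseq // => k kn.
rewrite nth_mkseq // /signed_app permE fv /v signed_val_ord //.
by rewrite gtr0_sg // mul1r.
Qed.

Lemma word_of_perm n :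
  perm_eq [seq word_of s | s <- enum (signed_perms n)] (signed_words n).
Proof.
apply: uniq_perm.
- rewrite map_inj_in_uniq ?enum_uniq // => s s'; rewrite !mem_enum.
  exact: word_of_inj.
- exact: signed_words_uniq.
move=> w; apply/mapP/idP => [[s + ->]|/signed_words_word_of[s sP <-]].
  by rewrite mem_enum => /word_of_signed_words.
by exists s; rewrite ?mem_enum.
Qed.

Lemma descentsE x w :
  descents x w = (\sum_(i < size w) (nth 0 (x :: w) i.+1 < nth 0 (x :: w) i)%R)%N.
Proof.
elim: w x => [|y w IH] x /=; first by rewrite big_ord0.
by rewrite big_ord_recl /= IH.
Qed.

Lemma desc_word_of n (s : 'S_(n.*2.+1)) : s \in signed_perms n ->
  desc s = descents 0 (word_of s).
Proof.
move=> sP; rewrite descentsE /desc -sum1dep_card big_mkcond size_mkseq /=.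
apply: eq_bigr => i _.
rewrite -[nth 0 (word_of s) i]/(nth 0 (0 :: word_of s) i.+1).
by rewrite !nth_word_of // 1?ltnW //; case: ifP.
Qed.

Lemma negatives_word_of n (s : 'S_(n.*2.+1)) :
  #|[set j in pos_image s | signed_val j < 0]%SET| = negatives (word_of s).
Proof.
pose f (k : 'I_n) := s (signed_ord n k.+1).
have f_inj : injective f.
  move=> k l /perm_inj /(congr1 (@signed_val n)).
  by rewrite !signed_val_ord // => -[] /val_inj.
have -> : [set j in pos_image s | signed_val j < 0]%SET =
    [set f k | k in [set k | signed_val (f k) < 0]]%SET.
  apply/setP => j; rewrite inE; apply/andP/imsetP.
    by move=> [/imsetP[k _ ->] k0]; exists k; rewrite ?inE.
  by move=> [k]; rewrite inE => k0 ->; split => //; apply: imset_f.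
rewrite card_imset // /negatives /word_of /mkseq count_map -val_enum_ord.
rewrite count_map.
by rewrite -sum1_card -sum1_count big_enum_cond; apply: eq_bigl => k; rewrite inE.
Qed.

Lemma polyD_signed_words (R : realType) n (t : R) :
  polyD n t =
  2^-1 * (\sum_(w <- signed_words n) t ^+ descents 0 w + (1 - t) ^+ n).
Proof.
rewrite -sum_signed_words_sign -big_split /=.
rewrite -(perm_big _ (word_of_perm n)) big_map big_enum /= big_distrr /=.
transitivity (\sum_(s in even_signed_perms n) t ^+ desc s).
  rewrite /polyD big_mkord.
  have dn (s : 'S_(n.*2.+1)) : (desc s < n.+1)%N.
    by rewrite ltnS /desc; apply: leq_trans (max_card _) _; rewrite card_ord.
  rewrite (partition_big (fun s => Ordinal (dn s)) xpredT) //=.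
  apply: eq_bigr => k _.
  rewrite (eq_bigr (fun=> t ^+ k)) => [|s /andP[_ /eqP <-]//].
  rewrite sumr_const mulr_natl; congr (_ *+ _); apply: eq_card => s.
  by rewrite finset.in_set [RHS]inE -val_eqE.
rewrite (eq_bigl (fun s => (s \in signed_perms n) &&
                           ~~ odd (negatives (word_of s)))); last first.
  by move=> s; rewrite !inE negatives_word_of.
rewrite big_mkcondr /=; apply: eq_bigr => s sP.
(* The factor (1 + (-1)^neg) / 2 is the indicator of an even number of negative letters. *)
rewrite desc_word_of // -signr_odd; case: odd => /=.
  by rewrite expr1 mulN1r subrr mulr0.
by rewrite expr0 mul1r; field.
Qed.

(** * Generating series *)

Lemma series_shift (R : realType) (u : R^nat) d (l : R) :
  (forall k, (k < d)%N -> u k = 0) ->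
  series (fun k => u (k + d)%N) @ \oo --> l -> series u @ \oo --> l.
Proof.
move=> u0 ul; rewrite -(cvg_shiftn d (series u)).
rewrite (_ : (fun n => series u (n + d)%N) = series (fun k => u (k + d)%N)) //.
apply/funext => n; rewrite /series /= addnC (big_cat_nat _ (leq_addr n d)) //=.
rewrite big_nat big1 ?add0r; last by move=> k /andP[_ /u0].
by rewrite -{1}[d]add0n big_addn addKn.
Qed.

(** Induction on [n]: by Pascal's rule, multiplying the partial sums for [n.+1] by [1 - t] gives
    those for [n] up to the boundary term [t * u m]. *)
Lemma cvg_series_binomial (R : realType) (t : R) n : 0 <= t < 1 ->
  series (fun k => 'C(k + n, n)%:R * t ^+ k) @ \oo --> (1 - t) ^- n.+1.
Proof.
move=> /andP[t0 t1].
have t'0 : 1 - t != 0 by rewrite subr_eq0 eq_sym lt_eqF.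
elim: n => [|n IH].
  have := cvg_geometric_series (a := 1) (z := t).
  rewrite ger0_norm // => /(_ t1); rewrite expr1 mul1r.
  rewrite (_ : geometric 1 t = fun k => 'C(k + 0, 0)%:R * t ^+ k) //.
  by apply/funext => k; rewrite /geometric /= addn0 bin0.
set u := (fun k => 'C(k + n.+1, n.+1)%:R * t ^+ k).
set v := (fun k => 'C(k + n, n)%:R * t ^+ k) in IH *.
have uv m : (1 - t) * series u m.+1 = series v m.+1 - t * u m.
  elim: m => [|m IHm].
    by rewrite /series /= !big_nat1 /u /v !add0n !binn expr0; ring.
  rewrite /series /= in IHm *.
  rewrite big_nat_recr //= [in RHS]big_nat_recr //= mulrDr.
  rewrite [X in X + _]IHm /u /v !addnS !addSn !binS exprS !natrD.
  by ring.
have u0 k : 0 <= u k by rewrite mulr_ge0 ?exprn_ge0.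
have v0 k : 0 <= v k by rewrite mulr_ge0 ?exprn_ge0.
(* Convergence comes first, from monotonicity and a bound, because it is what makes the boundary
   term tend to 0. *)
have cu : cvgn (series u).
  apply: nondecreasing_is_cvgn; first exact: nondecreasing_series.
  exists ((1 - t) ^- n.+2) => _ [m _ <-].
  have sv : series v m <= (1 - t) ^- n.+1.
    rewrite -(cvg_lim _ IH) //; apply: nondecreasing_cvgn_le.
      exact: nondecreasing_series.
    by apply: cvgP IH.
  rewrite exprS invfM ler_pdivlMl ?subr_gt0 //; apply: le_trans sv.
  case: m => [|m]; first by rewrite /series /= !big_geq ?mulr0.
  by rewrite uv lerBlDr lerDl mulr_ge0.
have -> : (1 - t) ^- n.+2 = (1 - t)^-1 * ((1 - t) ^- n.+1 - t * 0).
  by rewrite mulr0 subr0 exprS invfM.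
rewrite -(cvg_shiftS (series u)).
have -> : (fun m => series u m.+1) =
    (fun m => (1 - t)^-1 * (series v m.+1 - t * u m)).
  by apply/funext => m; rewrite -uv mulKf.
apply: cvgMl_tmp; apply: cvgB; first by rewrite cvg_shiftS.
by apply: cvgMl_tmp; apply: cvg_series_cvg_0.
Qed.

Lemma cvg_series_sum (R : realType) (I : eqType) (r : seq I)
    (f : I -> R^nat) (l : I -> R) :
  (forall i, i \in r -> series (f i) @ \oo --> l i) ->
  series (fun k => \sum_(i <- r) f i k) @ \oo --> \sum_(i <- r) l i.
Proof.
move=> fl; have -> : series (fun k => \sum_(i <- r) f i k) =
    (fun n => \sum_(i <- r) series (f i) n).
  by apply/funext => n; rewrite /series /= exchange_big.
elim: r fl => [|i r IH] fl.
  by under eq_fun do rewrite big_nil; rewrite big_nil; apply: cvg_cst.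
under eq_fun do rewrite big_cons; rewrite big_cons; apply: cvgD.
  by apply: fl; rewrite mem_head.
by apply: IH => j jr; apply: fl; rewrite inE jr orbT.
Qed.

(** The coefficients vanish for [k < d]; shifting the index by [d] leaves the negative binomial
    series. *)
Lemma cvg_series_binomial_shift (R : realType) (t : R) n d :
  0 <= t < 1 -> (d <= n)%N ->
  series (fun k => 'C(k + (n - d), n)%:R * t ^+ k) @ \oo -->
    t ^+ d * (1 - t) ^- n.+1.
Proof.
move=> t01 dn; apply: (@series_shift _ _ d) => [k kd|].
  by rewrite bin_small ?mul0r //; lia.
rewrite (_ : series _ =
    fun m => t ^+ d * series (fun k => 'C(k + n, n)%:R * t ^+ k) m).
  by apply: cvgMl_tmp; apply: cvg_series_binomial.
apply/funext => m; rewrite /series /= big_distrr /=; apply: eq_bigr => k _.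
by rewrite -addnA subnKC // exprD; ring.
Qed.

Lemma cvg_series_odd_powers (R : realType) (t : R) n : 0 <= t < 1 ->
  series (fun k => (2 * k + 1)%:R ^+ n * t ^+ k) @ \oo -->
    (\sum_(w <- signed_words n) t ^+ descents 0 w) * (1 - t) ^- n.+1.
Proof.
move=> t01; rewrite big_distrl /=.
rewrite (_ : (fun k => _) = fun k => \sum_(w <- signed_words n)
    ('C(k + (n - descents 0 w), n)%:R * t ^+ k)).
  apply: cvg_series_sum => w wn; apply: cvg_series_binomial_shift => //.
  by rewrite -(signed_words_size wn) descents_le_size.
apply/funext => k; rewrite -big_distrl /=; congr (_ * _).
rewrite (_ : (2 * k + 1)%:R = (1 + 1) * k%:R + 1) ?worpitzky; last first.
  by rewrite natrD natrM.
by apply: eq_bigr => w _; rewrite expr1n mul1r.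
Qed.

Lemma cvg_series_odd_powers_dual (R : realType) (t : R) n : 0 < t < 1 ->
  series (fun k => (2 * k + 1)%:R ^+ n * t ^+ k) @ \oo -->
    (\sum_(w <- signed_words n) t^-1 ^+ descents 0 w) *
      (t ^+ n * (1 - t) ^- n.+1).
Proof.
move=> /andP[t0 t1]; rewrite big_distrl /=.
rewrite (_ : (fun k => _) = fun k => \sum_(w <- signed_words n)
    ('C(k + descents 0 w, n)%:R * t ^+ k)).
  apply: cvg_series_sum => w wn.
  have dn : (descents 0 w <= n)%N.
    by rewrite -(signed_words_size wn) descents_le_size.
  rewrite mulrA (_ : _ * t ^+ n = t ^+ (n - descents 0 w)); last first.
    by rewrite -{1}(subnKC dn) exprD mulrA -exprMn mulVf ?gt_eqF // expr1n mul1r.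
  (* Reads [d] descents as [n - (n - d)], so that the shift lemma applies with [n - d]. *)
  rewrite -{1}(subKn dn).
  by apply: cvg_series_binomial_shift; rewrite ?leq_subr // (ltW t0).
apply/funext => k; rewrite -big_distrl /=; congr (_ * _).
rewrite (_ : (2 * k + 1)%:R = (1 + 1) * k%:R + 1) ?worpitzky_dual; last first.
  by rewrite natrD natrM.
by apply: eq_bigr => w _; rewrite expr1n mul1r.
Qed.

(** * Discrete laws *)

(** Normalising a measure of mass 1 does not change it but supplies the probability structure;
    [\d_x] is only the fallback value of [mnormalize]. *)
Lemma probability_of_measure d (T : measurableType d) (R : realType)
    (m : {measure set T -> \bar R}) (x : T) :
  m setT = 1%E -> exists P : probability T R, forall A, P A = m A.
Proof.
move=> m1; exists (mnormalize m \d_x) => A.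
by rewrite /= /mnormalize m1 onee_eq0 /= invr1 mule1.
Qed.

(** Serves to correct the atom of index 0, whose weight departs from the geometric pattern. *)
Lemma series_change0 (R : realType) (u v : R^nat) (l : R) :
  (forall k, u k.+1 = v k.+1) ->
  series u @ \oo --> l -> series v @ \oo --> v 0%N - u 0%N + l.
Proof.
move=> uv ul; rewrite -(cvg_shiftS (series v)).
rewrite (_ : (fun n => _) = fun n => v 0%N - u 0%N + series u n.+1).
  by apply: cvgD; [exact: cvg_cst|rewrite cvg_shiftS].
apply/funext => n; rewrite /series /= big_nat_recl // [in RHS]big_nat_recl //.
by under eq_bigr do rewrite -uv; rewrite addrA subrK.
Qed.

Lemma nneseries_cvg (R : realType) (u : R^nat) (l : R) :
  series u @ \oo --> l -> (\sum_(0 <= k <oo) (u k)%:E = l%:E)%E.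
Proof.
move=> ul; apply/cvg_lim => //; apply: cvg_EFin.
  by apply: nearW => n; rewrite sumEFin.
by rewrite (_ : fine \o _ = series u) //; apply/funext => n; rewrite /= sumEFin.
Qed.

Section discrete.
Local Open Scope ereal_scope.
Context d (T : measurableType d) (R : realType).
Implicit Types f : T -> R.

(** Extends scaling from nonnegative to integrable functions through positive and negative parts. *)
Lemma integral_mscale (mu : {measure set T -> \bar R}) (k : {nonneg R})
    (f : T -> \bar R) :
  mu.-integrable [set: T] f ->
  (mscale k mu).-integrable [set: T] f /\
  \int[mscale k mu]_x f x = k%:num%:E * \int[mu]_x f x.
Proof.
move=> fi; have [mf f_fin] := integrableP _ _ _ fi; split.
  apply/integrableP; split=> //.
  rewrite ge0_integral_mscale //; last exact: measurableT_comp.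
  by rewrite lte_mul_pinfty // lee_fin.
rewrite [LHS]integralE !ge0_integral_mscale //; last 2 first.
  exact: measurable_funeneg.
  exact: measurable_funepos.
rewrite -muleBr -?integralE //.
by rewrite fin_num_adde_defr // integrable_pos_fin_num.
Qed.

Lemma integral_scaled_dirac (w : {nonneg R}) (p : T) f :
  measurable_fun [set: T] f ->
  (mscale w \d_p).-integrable [set: T] (EFin \o f) /\
  \int[mscale w \d_p]_x (f x)%:E = (w%:num * f p)%:E.
Proof.
move=> mf.
have mEf : measurable_fun [set: T] (EFin \o f) by exact/measurable_EFinP.
have fi : (\d_p : {measure set T -> \bar R}).-integrable [set: T] (EFin \o f).
  apply/integrableP; split=> //.
  by rewrite integral_dirac ?diracT ?mul1e ?ltry //; exact: measurableT_comp.
have [wfi ->] := integral_mscale w fi; split=> //.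
by rewrite integral_dirac // diracT mul1e.
Qed.

Lemma integral_mseries_dirac (w : nat -> {nonneg R}) (p : nat -> T) f (l : R) :
  measurable_fun [set: T] f ->
  cvgn (series (fun k => (w k)%:num * `|f (p k)|)%R) ->
  series (fun k => (w k)%:num * f (p k))%R @ \oo --> l ->
  (mseries (fun k => mscale (w k) \d_(p k)) 0).-integrable [set: T] (EFin \o f) /\
  \int[mseries (fun k => mscale (w k) \d_(p k)) 0]_x (f x)%:E = l%:E.
Proof.
move=> mf /cvg_ex[/= L aL] fl; set m := mseries _ _.
have mEf : measurable_fun [set: T] (EFin \o f) by exact/measurable_EFinP.
have maf : measurable_fun [set: T] (fun x => `|f x|)%R by exact: measurableT_comp.
have intabs k : \int[mscale (w k) \d_(p k)]_x `|(EFin \o f) x| =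
    ((w k)%:num * `|f (p k)|)%:E by rewrite /= (integral_scaled_dirac _ _ _).2.
have intk k : (mscale (w k) \d_(p k)).-integrable [set: T] (EFin \o f).
  exact: (integral_scaled_dirac _ _ mf).1.
have sumabs : \int[m]_x `|(EFin \o f) x| = L%:E.
  rewrite ge0_integral_measure_series //; last exact: measurableT_comp.
  by under eq_eseriesr do rewrite intabs; exact: nneseries_cvg.
(* Applied to the positive and negative parts of [f], both dominated by its absolute value, to
   justify integrating against the series of measures termwise. *)
have part (g : T -> \bar R) : measurable_fun [set: T] g ->
    (forall x, 0 <= g x <= `|(EFin \o f) x|) ->
    \sum_(k <oo) `|\int[mscale (w k) \d_(p k)]_x g x| < +oo.
  move=> mg g0; apply: (@le_lt_trans _ _ L%:E); last exact: ltry.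
  rewrite -(nneseries_cvg aL); apply: lee_nneseries => // k _.
  rewrite gee0_abs; last by apply: integral_ge0 => x _; case/andP: (g0 x).
  rewrite -intabs; apply: ge0_le_integral => //.
  - by move=> x _; case/andP: (g0 x).
  - exact: measurableT_comp.
  - by move=> x _; case/andP: (g0 x).
split; first by apply/integrableP; split=> //; rewrite sumabs ltry.
rewrite integral_measure_series //.
- under eq_eseriesr do rewrite (integral_scaled_dirac _ _ mf).2.
  exact: nneseries_cvg.
- apply: part; first exact: measurable_funeneg.
  move=> x; rewrite funeneg_ge0 funenegE /= ge_max -?EFinN !lee_fin.
  by rewrite normr_ge0 -normrN ler_norm.
- apply: part; first exact: measurable_funepos.
  move=> x; rewrite funepos_ge0 funeposE /= ge_max !lee_fin.
  by rewrite normr_ge0 ler_norm.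
Qed.

End discrete.

(** * The exponential law *)

Lemma expr_expRN_cvg0 (R : realType) (r : R) n : 0 < r ->
  x ^+ n * expR (- r * x) @[x --> +oo] --> 0.
Proof.
(* The exponential of [r * x] is the power [n.+1] of that of [r * x / n.+1], hence at least
   [x ^+ n.+1 / c]; this bounds the function by [c / x]. *)
move=> r0; pose c := (n.+1%:R / r) ^+ n.+1.
have c0 : 0 < c by rewrite exprn_gt0 ?divr_gt0.
apply: (@squeeze_cvgr _ _ _ _ (fun=> 0) (fun x => c * x^-1)); last 2 first.
- exact: cvg_cst.
- rewrite -[X in _ --> X](mulr0 c); apply: cvgMl_tmp.
  apply/gtr0_cvgV0; last exact: cvg_id.
  exact: nbhs_pinfty_gt.
near=> x; have x0 : 0 < x by near: x; exact: nbhs_pinfty_gt.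
rewrite mulr_ge0 ?exprn_ge0 ?expR_ge0 ?(ltW x0) //=.
rewrite mulNr expRN ler_pdivrMr ?expR_gt0 // mulrAC ler_pdivlMr // -exprSr.
have -> : expR (r * x) = expR (x * (r / n.+1%:R)) ^+ n.+1.
  rewrite -expRM_natl; congr expR; field.
  by rewrite addrC natr1 pnatr_eq0.
rewrite /c -exprMn lerXn2r ?nnegrE ?mulr_ge0 ?expR_ge0 ?(ltW x0) //.
  by rewrite invr_ge0 ltW.
apply: (@le_trans _ _ (n.+1%:R / r * (x * (r / n.+1%:R)))).
  rewrite le_eqVlt; apply/orP; left; apply/eqP; field.
  by rewrite [1 + _]addrC natr1 pnatr_eq0 (gt_eqF r0).
rewrite ler_pM2l ?divr_gt0 //.
by apply: le_trans (expR_ge1Dx _); rewrite lerDr.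
Unshelve. all: by end_near. Qed.

(** Integration by parts gives the recursion F_(n+1) = ((n+1)/r) F_n - x^(n+1) e^(-rx); since F
    tends to 0, the moment will be -F(0). *)
Lemma exponential_moment_primitive (R : realType) (r : R) n : 0 < r ->
  exists F : R -> R,
    [/\ forall x : R, is_derive x 1 F (x ^+ n * (r * expR (- r * x))),
        F x @[x --> +oo] --> 0 & F 0 = - (n`!%:R / r ^+ n)].
Proof.
move=> r0.
have dexp (x : R) :
    is_derive x 1 (fun y => expR (- r * y)) (- r * expR (- r * x)).
  have d1 : is_derive x 1 (fun y : R => - r * y) (- r).
    by apply: is_derive_eq; rewrite /GRing.scale /= mulr1.
  have d2 := is_derive1_comp (is_derive_expR (- r * x)) d1.
  by rewrite mulrC; exact: d2.
elim: n => [|n [F [dF F0 F00]]].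
  exists (fun x => - expR (- r * x)); split.
  - by move=> x; apply: is_derive_eq; rewrite expr0 mul1r mulNr opprK.
  - rewrite -oppr0; apply: cvgN.
    by have := expr_expRN_cvg0 0 r0; under eq_fun do rewrite expr0 mul1r.
  - by rewrite mulr0 expR0 fact0 expr0 divr1.
exists (fun x => n.+1%:R / r * F x - x ^+ n.+1 * expR (- r * x)); split.
- move=> x; have dX := is_deriveX n.+1 (is_derive_id x (1 : R)).
  have := is_deriveB (is_deriveZ (n.+1%:R / r) (dF x)) (is_deriveM dX (dexp x)).
  rewrite (_ : _ - _ * _ =
      fun y => n.+1%:R / r * F y - y ^+ n.+1 * expR (- r * y)).
    move=> h; apply: (is_derive_eq h).
    rewrite exprfctE /GRing.scale /= exprS; field.
    by rewrite gt_eqF.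
  by apply/funext => y; rewrite !fctE.
- rewrite -[X in _ --> X](subrr 0) -{1}(mulr0 (n.+1%:R / r)).
  by apply: cvgB; [apply: cvgMl_tmp|apply: expr_expRN_cvg0].
- rewrite F00 expr0n /= mul0r subr0 factS natrM exprS; field.
  by rewrite (gt_eqF r0) ?andbT ?expf_neq0 ?(gt_eqF r0).
Qed.

Lemma integral_exponential_moment (R : realType) (r : R) n : 0 < r ->
  (\int[lebesgue_measure]_(x in `[0%R, +oo[) (x ^+ n * (r * expR (- r * x)))%:E
   = (n`!%:R / r ^+ n)%:E)%E.
Proof.
move=> r0; have [F [dF Foo F0]] := exponential_moment_primitive n r0.
have cF (x : R) : {for x, continuous F}.
  by apply/differentiable_continuous/derivable1_diffP; apply: ex_derive.
have cf : continuous (fun x : R => x ^+ n * (r * expR (- r * x))).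
  move=> x; apply: cvgM; first exact: exprn_continuous.
  apply: cvgMl_tmp; apply: continuous_comp; last exact: continuous_expR.
  exact: mulrl_continuous.
rewrite (ge0_continuous_FTC2y (F := F) (l := 0)) //.
- by rewrite F0 sub0e EFinN oppeK.
- by move=> x x0; rewrite !mulr_ge0 ?exprn_ge0 ?expR_ge0 ?(ltW r0).
- exact: continuous_subspaceT.
- by apply: cvg_at_right_filter; exact: cF.
- by move=> x _; rewrite derive1E derive_val.
Qed.

(** The measure [nu] is dominated by [mu], and its Radon-Nikodym derivative equals [g] almost
    everywhere because both have the same integral over every measurable set. *)
Lemma ge0_integral_density d (T : measurableType d) (R : realType)
    (nu : {finite_measure set T -> \bar R})
    (mu : {sigma_finite_measure set T -> \bar R}) (g f : T -> \bar R) :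
  (forall x, 0 <= f x)%E -> measurable_fun [set: T] f ->
  measurable_fun [set: T] g ->
  (forall A, measurable A -> nu A = \int[mu]_(x in A) g x)%E ->
  (\int[nu]_x f x = \int[mu]_x (f x * g x))%E.
Proof.
move=> f0 mf mg nug.
have numu : nu `<< mu.
  apply/null_content_dominatesP => A mA A0; rewrite nug //.
  by rewrite null_set_integral //; exact: measurable_funTS.
rewrite -(Radon_Nikodym_SigmaFinite.change_of_variables numu) //.
have intD := Radon_Nikodym_SigmaFinite.f_integrable numu.
have mD := measurable_int _ intD.
apply: ae_eq_integral => //; try exact: emeasurable_funM.
apply: ae_eqe_mul2l; apply: integral_ae_eq => // A _ mA.
by rewrite -nug // -Radon_Nikodym_SigmaFinite.f_integral.
Qed.

Lemma exponential_probability (R : realType) (r : R) : 0 < r ->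
  exists nu : probability (measurableTypeR R) R,
    (forall A, nu A = exponential_prob r A) /\
    forall n, nu.-integrable [set: measurableTypeR R] (fun x => (x ^+ n)%:E) /\
      (\int[nu]_x (x ^+ n)%:E = (n`!%:R / r ^+ n)%:E)%E.
Proof.
move=> r0; pose nu : probability (measurableTypeR R) R :=
  exponential_distribution_exponential_prob__canonical__probability_measure_Probability r0.
exists nu; split=> // n.
have mX : measurable_fun [set: measurableTypeR R] (fun x : R => (x ^+ n)%:E).
  by apply/measurable_EFinP; exact: measurable_funX.
have density (f : R -> \bar R) : (forall x, 0 <= f x)%E ->
    measurable_fun [set: measurableTypeR R] f ->
    (\int[nu]_x f x =
     \int[lebesgue_measure]_(x in `[0%R, +oo[)
       (f x * (r * expR (- r * x))%:E))%E.
  move=> f0 mf; rewrite [RHS]integral_mkcond.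
  rewrite (@ge0_integral_density _ _ _ nu lebesgue_measure
    (EFin \o exponential_pdf r)) //.
    apply: eq_integral => x _; rewrite /exponential_pdf /= !patchE.
    by case: ifP => //; rewrite mule0.
  by apply/measurable_EFinP; exact: measurable_exponential_pdf.
(* Only the values on the half-line matter, so this handles both the absolute value and the positive
   part of [x ^+ n]. *)
have moment (g : R -> \bar R) : (forall x, 0 <= g x)%E ->
    measurable_fun [set: measurableTypeR R] g ->
    (forall x : R, 0 <= x -> g x = (x ^+ n)%:E) ->
    (\int[nu]_x g x = (n`!%:R / r ^+ n)%:E)%E.
  move=> g0 mg gX; rewrite density // -integral_exponential_moment //.
  by apply: eq_integral => x; rewrite inE /= in_itv /= andbT => x0; rewrite gX.
have moment_abs : (\int[nu]_x `|(x ^+ n)%:E| = (n`!%:R / r ^+ n)%:E)%E.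
  apply: moment => //; first exact: measurableT_comp.
  by move=> x x0; rewrite gee0_abs // lee_fin exprn_ge0.
split; first by apply/integrableP; split=> //; rewrite moment_abs ltry.
rewrite integralE moment //; last 2 first.
  exact: measurable_funepos.
  by move=> x x0; rewrite funeposE /=; apply/max_idPl; rewrite lee_fin exprn_ge0.
rewrite density //; last exact: measurable_funeneg.
rewrite integral0_eq ?sube0 // => x; rewrite /= in_itv /= andbT => x0.
rewrite funenegE (_ : maxe _ _ = 0%E) ?mul0e //.
by apply/max_idPr; rewrite -EFinN lee_fin oppr_le0 exprn_ge0.
Qed.

(** * The representing measures *)

Definition represents (R : realType) (t : R)
    (m : set (measurableTypeR R) -> \bar R) :=
  (forall A, measurable A -> m A = muD t A) /\
  forall n, m.-integrable [set: measurableTypeR R] (fun x => (x ^+ n)%:E) /\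
    (\int[m]_x (x ^+ n)%:E = (polyD n t)%:E)%E.

Lemma represents_lt1 (R : realType) (t : R) : 0 <= t < 1 ->
  exists m : {measure set (measurableTypeR R) -> \bar R}, represents t m.
Proof.
move=> /andP[t0 t1].
have t1' : 0 < 1 - t by rewrite subr_gt0.
have w_ge0 (k : nat) :
    0 <= if k is 0 then (2 - t) / 2 else (1 - t) * t ^+ k / 2.
  case: k => [|k]; rewrite divr_ge0 ?mulr_ge0 ?exprn_ge0 ?(ltW t1') //.
  by rewrite subr_ge0 (le_trans (ltW t1)) // ler1n.
pose w k := NngNum (w_ge0 k).
pose p (k : nat) : measurableTypeR R := (2 * k + 1)%:R * (1 - t).
exists (mseries (fun k => mscale (w k) \d_(p k)) 0); split=> [A mA|n].
  transitivity (((2 - t) / 2)%:E * \d_((1 - t)%R : measurableTypeR R) A +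
      \sum_(0 <= k <oo) ((1 - t) * t ^+ k.+1 / 2)%:E * \d_(p k.+1) A)%E.
    rewrite /= /mseries nneseries_recl // -(nneseries_addn 1) //; congr +%E.
      by rewrite /mscale /= /p muln0 add0n mul1r.
    by apply: eq_eseriesr => k _; rewrite addn1.
  rewrite /muD t1; have [t_0|tn0] := eqVneq t 0.
    (* At [t = 0] every atom of positive index has weight 0, which leaves the Dirac mass at 1. *)
    rewrite eseries0 ?adde0 => [|k _ _]; last first.
      by rewrite t_0 exprS mul0r mulr0 mul0r mul0e.
    by rewrite t_0 !subr0 divff ?pnatr_eq0 // mul1e.
  congr +%E; rewrite -(nneseries_addn 1) => [|k].
    by apply: eq_eseriesr => k _; rewrite addn1.
  by rewrite mule_ge0 // lee_fin divr_ge0 ?mulr_ge0 ?exprn_ge0 ?(ltW t1').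
have cv : series (fun k => (w k)%:num * p k ^+ n) @ \oo --> polyD n t.
  have /(@cvg_series_odd_powers R t n) : 0 <= t < 1 by rewrite t0.
  set S := \sum_(_ <- _) _ => cvS.
  (* The moment series with the geometric weight [(1 - t) / 2] at index 0 as well; the true weight
     there exceeds it by 1/2, which contributes [(1 - t) ^+ n / 2]. *)
  pose u k := (1 - t) ^+ n.+1 / 2 * ((2 * k + 1)%:R ^+ n * t ^+ k).
  have cu : series u @ \oo --> (1 - t) ^+ n.+1 / 2 * (S * (1 - t) ^- n.+1).
    rewrite (_ : series u = fun m => (1 - t) ^+ n.+1 / 2 *
      series (fun k => (2 * k + 1)%:R ^+ n * t ^+ k) m); first exact: cvgMl_tmp.
    by apply/funext => m; rewrite /series /= big_distrr.
  have := series_change0 (v := fun k => (w k)%:num * p k ^+ n) _ cu.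
  set l := (X in (_ -> _ --> X) -> _).
  rewrite (_ : l = polyD n t); first (apply => k; rewrite /u /w /p /=).
    by rewrite exprMn [(1 - t) ^+ n.+1]exprS; field.
  rewrite /l /u /w /p polyD_signed_words -/S /= muln0 add0n.
  rewrite expr1n expr0 mul1r !mulr1 exprS.
  have : (1 - t) ^+ n != 0 by rewrite expf_neq0 ?gt_eqF.
  by rewrite !mul1r; move: ((1 - t) ^+ n) => e e0; field; rewrite e0 gt_eqF.
have p_ge0 k : 0 <= p k by rewrite mulr_ge0 // ltW.
apply: (@integral_mseries_dirac _ (measurableTypeR R) R w p
  (fun x : R => x ^+ n)) => //.
rewrite (_ : (fun k => _) = fun k => (w k)%:num * p k ^+ n).
  by apply/cvg_ex; exists (polyD n t).
by apply/funext => k; rewrite ger0_norm ?exprn_ge0.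
Qed.

Lemma represents_gt1 (R : realType) (t : R) : 1 < t ->
  exists m : {measure set (measurableTypeR R) -> \bar R}, represents t m.
Proof.
move=> t1.
have t1' : 0 < t - 1 by rewrite subr_gt0.
have t0 : 0 < t by rewrite (lt_trans ltr01).
have v_ge0 k : 0 <= (t - 1) / (2 * t ^+ k.+1).
  by rewrite divr_ge0 ?mulr_ge0 ?exprn_ge0 ?(ltW t1') ?(ltW t0).
have w_ge0 (k : nat) :
    0 <= if k is j.+1 then (t - 1) / (2 * t ^+ j.+1) else 2^-1.
  by case: k => [|k]; rewrite ?invr_ge0.
pose w k := NngNum (w_ge0 k).
(* Index 0 is reserved for the separate atom at the negative point [1 - t]; the geometric atoms are
   shifted by one. *)
pose p (k : nat) : measurableTypeR R :=
  if k is j.+1 then (2 * j + 1)%:R * (t - 1) else 1 - t.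
exists (mseries (fun k => mscale (w k) \d_(p k)) 0); split=> [A mA|n].
  rewrite /= /mseries nneseries_recl // -(nneseries_addn 1) // /muD.
  rewrite !ifF ?gt_eqF // ?ltNge ?(ltW t1) //.
  by congr +%E; apply: eq_eseriesr => k _; rewrite addn1.
pose S := \sum_(w <- signed_words n) t ^+ descents 0 w.
(* The law at [t] is governed by the type B series at [t^-1]. *)
pose v (k : nat) :=
  (t - 1) ^+ n.+1 / (2 * t) * ((2 * k + 1)%:R ^+ n * t^-1 ^+ k).
have cv : series v @ \oo --> S / 2.
  have /(@cvg_series_odd_powers_dual R t^-1 n) : 0 < t^-1 < 1.
    by rewrite invr_gt0 t0 invf_lt1.
  rewrite invrK -/S => cS.
  rewrite (_ : series v = fun m => (t - 1) ^+ n.+1 / (2 * t) *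
    series (fun k => (2 * k + 1)%:R ^+ n * t^-1 ^+ k) m); last first.
    by apply/funext => m; rewrite /series /= big_distrr.
  rewrite [X in _ --> X](_ : _ = (t - 1) ^+ n.+1 / (2 * t) *
    (S * (t^-1 ^+ n / (1 - t^-1) ^+ n.+1))); first exact: cvgMl_tmp.
  have -> : 1 - t^-1 = (t - 1) / t by field; rewrite gt_eqF.
  rewrite expr_div_n exprVn [t ^+ n.+1]exprS.
  have : t ^+ n != 0 by rewrite expf_neq0 ?gt_eqF.
  have : (t - 1) ^+ n.+1 != 0 by rewrite expf_neq0 ?gt_eqF.
  move: (t ^+ n) ((t - 1) ^+ n.+1) => e e' e0 e'0; field.
  by rewrite e0 e'0 gt_eqF.
pose v1 k := if k is j.+1 then v j else 0.
have cv1 : series v1 @ \oo --> S / 2.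
  apply: (@series_shift R v1 1); first by case.
  by rewrite (_ : (fun k => _) = v) //; apply/funext => k; rewrite addn1.
have vE k : v k = (w k.+1)%:num * p k.+1 ^+ n.
  rewrite /v /w /p /= exprMn [(t - 1) ^+ n.+1]exprS [t ^+ k.+1]exprS exprVn.
  have : t ^+ k != 0 by rewrite expf_neq0 ?gt_eqF.
  move: (t ^+ k) ((t - 1) ^+ n) => e e' e0; field.
  by rewrite e0 gt_eqF.
apply: (@integral_mseries_dirac _ (measurableTypeR R) R w p
  (fun x : R => x ^+ n)) => //.
(* Only the atom of index 0 is negative, so absolute values alter that single term. *)
- apply/cvg_ex; exists (2^-1 * `|(1 - t) ^+ n| - 0 + S / 2).
  apply: (@series_change0 _ v1) => // k.
  rewrite /v1 vE ger0_norm // exprn_ge0 // /p mulr_ge0 //.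
  exact: ltW.
- rewrite polyD_signed_words -/S (_ : _ * _ = 2^-1 * (1 - t) ^+ n - 0 + S / 2).
    by apply: (@series_change0 _ v1) => // k; rewrite /v1 vE.
  by field.
Qed.

Lemma represents_eq1 (R : realType) :
  exists m : {measure set (measurableTypeR R) -> \bar R}, represents (1 : R) m.
Proof.
have h0 : 0 <= (2^-1 : R) by rewrite invr_ge0.
have h0' : 0 < (2^-1 : R) by rewrite invr_gt0.
have [nu [nuE nuX]] := exponential_probability h0'.
pose h := NngNum h0.
exists (measure_add (mscale h \d_(0 : measurableTypeR R)) (mscale h nu)).
split=> [A mA|n].
  rewrite [LHS]measure_addE /muD oner_eq0 ltxx eqxx /mscale /=; congr +%E.
  transitivity (2^-1%:E * exponential_prob 2^-1 A)%E; first by rewrite -nuE.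
  (* The density in the statement is half the exponential density of rate 1/2. *)
  rewrite /exponential_prob -ge0_integralZl //.
  - apply: eq_integral => x _; rewrite /exponential_pdf patchE -EFinM; congr EFin.
    rewrite indicE; case: ifP => _; last by rewrite !mulr0.
    rewrite mulr1 !mulrA; congr (_ * expR _); first by field.
    by field.
  - apply/measurable_EFinP; apply: measurable_funTS.
    exact: measurable_exponential_pdf.
  - by move=> x _; rewrite lee_fin exponential_pdf_ge0.
have mX : measurable_fun [set: measurableTypeR R] (fun x : R => (x ^+ n)%:E).
  by apply/measurable_EFinP; exact: measurable_funX.
have [di dE] := @integral_scaled_dirac _ (measurableTypeR R) R h 0
  (fun x : R => x ^+ n)
  (measurable_funX n (@measurable_id _ _ setT)).
have [nuXi nuXE] := nuX n.
have [ni nE] := integral_mscale h nuXi.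
split.
  apply/integrableP; split=> //.
  rewrite ge0_integral_measure_add //; last exact: measurableT_comp.
  by rewrite lte_add_pinfty //; [case/integrableP: di|case/integrableP: ni].
rewrite integral_measure_add // dE nE nuXE -EFinM -EFinD; congr EFin.
(* Here [(1 - t) ^+ n] becomes [0 ^+ n], the moment of the Dirac mass at 0, equal to 1 when
   [n = 0]. *)
rewrite polyD_signed_words subrr /=.
under [in RHS]eq_bigr do rewrite expr1n.
rewrite big_const_seq count_predT iter_addr_0 size_signed_words natrM natrX.
by rewrite exprVn invrK; ring.
Qed.

Lemma represents_measure (R : realType) (t : R) : 0 <= t ->
  exists m : {measure set (measurableTypeR R) -> \bar R}, represents t m.
Proof.
move=> t0; have [t1|t1|->] := ltgtP t 1.
- by apply: represents_lt1; rewrite t0.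
- exact: represents_gt1.
- exact: represents_eq1.
Qed.

(** The quadratic form is the integral of the square of the polynomial with coefficients [c]. *)
Lemma moments_positive_definite (R : realType)
    (mu : {measure set (measurableTypeR R) -> \bar R}) (a : nat -> R) :
  (forall n, mu.-integrable [set: measurableTypeR R] (fun x => (x ^+ n)%:E) /\
    (\int[mu]_x (x ^+ n)%:E = (a n)%:E)%E) ->
  positive_definite_seq a.
Proof.
move=> muX c N _.
pose f i j (x : measurableTypeR R) := ((c i * c j)%:E * (x ^+ (i + j))%:E)%E.
have fi i j : mu.-integrable [set: measurableTypeR R] (f i j).
  by apply: integrableZl => //; case: (muX (i + j)%N).
have fE i j : (\int[mu]_x f i j x = (a (i + j)%N * c i * c j)%:E)%E.
  have [Xi XE] := muX (i + j)%N.
  by rewrite integralZl // XE -EFinM; congr EFin; ring.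
rewrite -lee_fin -sumEFin; under eq_bigr do rewrite -sumEFin.
rewrite (_ : (\sum_(_ <- _) _)%E =
  \int[mu]_x \sum_(0 <= i < N) \sum_(0 <= j < N) f i j x)%E.
  apply: integral_ge0 => x _; rewrite /f.
  under eq_bigr do under eq_bigr do rewrite -EFinM.
  under eq_bigr do rewrite sumEFin.
  rewrite sumEFin lee_fin.
  rewrite (_ : \sum_(_ <- _) _ = (\sum_(0 <= i < N) c i * x ^+ i) ^+ 2) ?sqr_ge0 //.
  rewrite expr2 big_distrl /=; apply: eq_bigr => i _.
  by rewrite big_distrr /=; apply: eq_bigr => j _; rewrite exprD; ring.
rewrite integral_sum // => [|i]; last exact: integrable_sum.
apply: eq_bigr => i _; rewrite integral_sum //.
by apply: eq_bigr => j _; rewrite fE.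
Qed.

Theorem theorem4p9 (R : realType) (t : R) (t_ge0 : 0 <= t) :
  (exists mu : probability (measurableTypeR R) R,
     (forall A : set (measurableTypeR R), measurable A -> mu A = muD t A) /\
     (forall n : nat,
        mu.-integrable [set: measurableTypeR R] (fun x => (x ^+ n)%:E) /\
        (\int[mu]_(x in [set: measurableTypeR R]) (x ^+ n)%:E
           = (polyD n t)%:E)%E)) /\
  positive_definite_seq (fun n => polyD n t).
Proof.
have [m [mE mX]] := represents_measure t_ge0.
split; last exact: moments_positive_definite mX.
(* The total mass is read off the moment of order 0, since P_0 = 1, instead of summing the
   weights. *)
have m1 : m setT = 1%E.
  have [_ X0] := mX 0%N; move: X0.
  under eq_integral do rewrite expr0.
  rewrite integral_cst // mul1e => ->; congr EFin.
  by rewrite polyD_signed_words expr0 big_seq1 /= expr0; field.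
have [mu muE] := probability_of_measure (0 : measurableTypeR R) m1.
exists mu; split=> [A mA|n]; first by rewrite muE mE.
have [/integrableP[mXn Xn_fin] XnE] := mX n.
have mu_int f : (\int[mu]_x f x = \int[m]_x f x)%E.
  by apply: eq_measure_integral => A _ _; exact: muE.
by split; [apply/integrableP; split => //; rewrite mu_int|rewrite mu_int].
Qed.
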